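(* Let $S_n=X_1+\cdots+X_n$ be a sum of independent Bernoulli random variables with $\mathbb{P}(X_j=1)=1-\mathbb{P}(X_j=0)=p_j$, and let $\lambda=\sum_{j=1}^np_j>0$, $\lambda_2=\sum_{j=1}^np_j^2$, $\theta=\lambda_2/\lambda$. Assume $\theta<1$, and let $c_1=\sqrt e-1$. Then: (i) ($\chi^2$-distance) $$\sum_{m\ge0}\left|\frac{\mathbb{P}(S_n=m)}{e^{-\lambda}\frac{\lambda^m}{m!}}-1\right|^2e^{-\lambda}\frac{\lambda^m}{m!}\le\frac{2c_1^2\theta^2}{(1-\theta)^3};$$ (ii) (total variation distance) $$\frac12\sum_{m\ge0}\left|\mathbb{P}(S_n=m)-e^{-\lambda}\frac{\lambda^m}{m!}\right|\le\frac{c_1\theta}{\sqrt2\,(1-\theta)^{3/2}};$$ (iii) (Wasserstein distance) $$\sum_{m\ge0}\left|\mathbb{P}(S_n\le m)-\sum_{0\le j\le m}e^{-\lambda}\frac{\lambda^j}{j!}\right|\le\frac{c_1\lambda_2}{\sqrt\lambda\,(1-\theta)};$$ and for every integer $m\ge0$: (iv) $$\left|\mathbb{P}(S_n\le m)-\sum_{0\le j\le m}e^{-\lambda}\frac{\lambda^j}{j!}\right|\le\frac{\sqrt2\,c_1\theta}{(1-\theta)^{3/2}}\sqrt{Z(m)};$$ (v) $$\left|\mathbb{P}(S_n=m)-e^{-\lambda}\frac{\lambda^m}{m!}\right|\le\frac{\sqrt6\,c_1\theta}{(1-\theta)^2\sqrt\lambda}\sqrt{Z(m)}.$$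
   Context: For an integer $m\ge0$, $Z(m):=\min\{\mathbb{P}(\zeta_\lambda\le m),\mathbb{P}(\zeta_\lambda>m)\}$, where $\zeta_\lambda$ is a Poisson random variable with mean $\lambda$. *)

(* Defs.v *)
From HB Require Import structures.
From mathcomp Require Import all_boot all_order all_algebra.
From mathcomp Require Import all_classical all_reals all_analysis.

Set Implicit Arguments.
Unset Strict Implicit.
Unset Printing Implicit Defensive.

Import Order.TTheory GRing.Theory Num.Theory.
Import numFieldNormedType.Exports.

Local Open Scope classical_set_scope.
Local Open Scope ring_scope.

Definition mutually_independent d d' (T : measurableType d)
    (T' : measurableType d') (R : realType) (P : probability T R)
    (I : finType) (X : I -> {RV P >-> T'}) : Prop :=
  forall (J : {set I}) (A : I -> set T'),
    (forall i, measurable (A i)) ->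
    P (\bigcap_(i in [set` J]) (X i @^-1` A i)) =
    (\prod_(i in J) P (X i @^-1` A i))%E.

Definition is_bernoulli d (T : measurableType d) (R : realType)
    (P : probability T R) (X : {RV P >-> R}) (p : R) : Prop :=
  P [set w | X w = 1] = p%:E /\ P [set w | X w = 0] = (1 - p)%:E.

(* The second argument of [poisson_prob] is not used in its definition, so
   [0%N] below is arbitrary. *)
Definition poisson_tail_min (R : realType) (lambda : R) (m : nat) : R :=
  Num.min (fine (poisson_prob lambda 0%N [set k | (k <= m)%N]))
          (fine (poisson_prob lambda 0%N [set k | (m < k)%N])).

(* Main.v *)
(** Put [w = z - 1].  The generating function of the law of [S] is
    [exp (lambda w) * A w] with [A w = \prod_j (1 + p_j w) exp (- p_j w)], so the
    law of [S] is the image of the coefficients [a_j] of [A] under a map that,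
    by Parseval for the Charlier polynomials, sends the weighted norm
    [\sum_j j! / lambda ^ j * a_j ^ 2] to the chi-square norm relative to the
    Poisson law.  Multiplying by [w] is taking minus the backward difference, so
    the distribution functions correspond to [(A - 1) / w], and the pointwise
    bounds follow from Cauchy-Schwarz applied to the partial sums of the
    sequences attached to [A - 1] and to [w (A - 1)].

    Everything reduces to [a_j ^ 2 <= c1 ^ 2 lambda2 ^ j / (j - 2)!] for
    [2 <= j].  For [j <= 4] this is read off from Newton's identities, and for
    [5 <= j] from Cauchy's estimate on the circle of radius [sqrt (j / lambda2)],
    where [|A w| ^ 2 <= exp (lambda2 |w| ^ 2)] because
    [|1 + x w| ^ 2 <= exp (2 x Re w + x ^ 2 |w| ^ 2)].

    To deal with polynomials only, [exp (- lambda w)] is replaced by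
    [(1 - lambda w / N) ^ N], which only adds roots to the product, and [N] tends
    to infinity in the final inequalities. *)

Require Import Defs.
From HB Require Import structures.
From mathcomp Require Import all_boot all_order all_algebra.
From mathcomp Require Import all_classical all_reals all_analysis.
From mathcomp Require Import ring lra zify.
From mathcomp Require Import cyclic separable cyclotomic.
From mathcomp Require complex.

Import Order.TTheory GRing.Theory Num.Theory.
Import numFieldNormedType.Exports.

Local Open Scope classical_set_scope.
Local Open Scope ring_scope.

(** * Coefficients of products of linear factors *)

(** In characteristic 0 the polynomial ['X^n - 1] is separable, so it has [n] distinct roots, and
    such a list of roots of unity contains a primitive one. *)
Lemma closed_prim_root (C : numClosedFieldType) n :
  (0 < n)%N -> exists z : C, n.-primitive_root z.
Proof.
pose p : {poly C} := 'X^n - 1; have [r Dp] := closed_field_poly_normal p.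
move=> n_gt0; rewrite (monicP _) ?monicXnsubC // scale1r in Dp.
have rn1: all n.-unity_root r by apply/allP=> z; rewrite -root_prod_XsubC -Dp.
have sz_r: (n < (size r).+1)%N.
  by rewrite -(size_prod_XsubC r id) -Dp size_XnsubC.
have [|z] := hasP (has_prim_root n_gt0 rn1 _ sz_r); last by exists z.
by rewrite -separable_prod_XsubC -Dp separable_Xn_sub_1 // pnatr_eq0 -lt0n.
Qed.

Lemma sum_prim_root (C : fieldType) N (w : C) i : N.-primitive_root w ->
  \sum_(l < N) (w ^+ i) ^+ l = if (N %| i)%N then N%:R else 0.
Proof.
move=> pw; rewrite -[RHS]mulr1.
have [Ni|Ni] := boolP (N %| i)%N.
  have -> : w ^+ i = 1 by apply/eqP; rewrite -(prim_order_dvd pw).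
  under eq_bigr do rewrite expr1n.
  by rewrite sumr_const card_ord mulr1.
have wi1 : w ^+ i - 1 != 0 by rewrite subr_eq0 -(prim_order_dvd pw).
apply: (mulfI wi1).
by rewrite -subrX1 -exprM mulnC exprM
  (prim_expr_order pw) expr1n subrr mul0r mulr0.
Qed.

(* Averaging over roots of unity of order larger than the degree replaces the
   contour integral. *)
Lemma cauchy_coef_estimate (C : numClosedFieldType) (q : {poly C}) (r B : C) :
  0 <= r -> (forall z, `|z| = r -> `|q.[z]| <= B) ->
  forall j, `|q`_j| * r ^+ j <= B.
Proof.
(* Taking [N > j] as well keeps [j] among the summation indices when it exceeds the degree of
   [q]. *)
move=> r0 qB j; set N := maxn (size q) j.+1.
have N0 : (0 < N)%N by rewrite leq_max orbT.
have jN : (j < N)%N by rewrite leq_max leqnn orbT.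
have [w pw] := closed_prim_root C _ N0.
have w1 : `|w| = 1.
  apply/eqP; rewrite -(@pexpr_eq1 _ _ N)// -normrX (prim_expr_order pw).
  by rewrite normr1.
have key : q`_j * r ^+ j * N%:R =
    \sum_(l < N) q.[r * w ^+ l] * (w ^+ l) ^+ (N - j).
  have qE l : q.[r * w ^+ l] * (w ^+ l) ^+ (N - j) =
      \sum_(k < N) q`_k * r ^+ k * (w ^+ (k + (N - j))) ^+ l.
    rewrite (@horner_coef_wide _ N) ?leq_max ?leqnn// mulr_suml.
    apply: eq_bigr => k _; rewrite exprMn -!exprM -!mulrA -exprD.
    by rewrite -mulnDr mulnC.
  under eq_bigr do rewrite qE.
  rewrite exchange_big /=.
  under eq_bigr do rewrite -mulr_sumr sum_prim_root//.
  (* For [k, j < N], the order [N] divides [k + (N - j)] only if [k = j]. *)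
  rewrite (bigD1 (Ordinal jN)) //= subnKC; last exact: ltnW.
  rewrite dvdnn big1 ?addr0// => k kj.
  case: ifP => [/dvdnP[c]|]; last by rewrite mulr0.
  have kN := ltn_ord k; have {}kj : (k : nat) <> j.
    by move=> e; case/eqP: kj; apply: val_inj.
  case: c => [|[|c]]; rewrite ?mulSn; lia.
have N0' : 0 < N%:R :> C by rewrite ltr0n.
rewrite -(ler_pM2r N0') -[r]ger0_norm// -normrX -(normr_nat C N) -!normrM key.
apply: le_trans (ler_norm_sum _ _ _) _.
rewrite normr_nat mulr_natr -[X in B *+ X]card_ord -sumr_const.
apply: ler_sum => l _; rewrite normrM !normrX w1 !expr1n mulr1.
by apply: qB; rewrite normrM normrX w1 expr1n mulr1 ger0_norm.
Qed.

Section coefficient_estimate.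
Import complex.

Lemma prod_1Dx_coef_sqr_le (R : realType) (xs : seq R) (t : R) j : 0 <= t ->
  \sum_(x <- xs) x = 0 ->
  (\prod_(x <- xs) (1 + x *: 'X))`_j ^+ 2 * t ^+ j
    <= expR (t * \sum_(x <- xs) x ^+ 2).
Proof.
move=> t0 xs0; set q := \prod_(x <- xs) _; set s := \sum_(x <- xs) x ^+ 2.
pose q' := map_poly (complex.real_complex R) q.
have q'E z : q'.[z] = \prod_(x <- xs) (1 + complex.real_complex R x * z).
  rewrite /q' /q rmorph_prod horner_prod; apply: eq_bigr => x _.
  by rewrite rmorphD rmorph1 /= map_polyZ /= map_polyX !hornerE.
have qB z : `|z| = complex.real_complex R (Num.sqrt t) ->
    `|q'.[z]| <= complex.real_complex R (expR (t * s / 2)).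
  move=> zt.
  have zt2 : complex.Re z ^+ 2 + complex.Im z ^+ 2 = t.
    apply: complex.complexI; rewrite complex.add_Re2_Im2 zt -rmorphXn /=.
    by rewrite sqr_sqrtr.
  rewrite -(@ler_pXn2r _ 2) ?nnegrE ?normr_ge0//; last first.
    by rewrite complex.ler0c expR_ge0.
  rewrite -[leRHS]rmorphXn -expRM_natl mulrCA divff ?pnatr_eq0// mulr1.
  (* The inserted terms [2 * (x * Re z)] add up to zero, since the [x] do; with them each factor is
     bounded separately by [1 + u <= expR u]. *)
  have -> : t * s = \sum_(x <- xs) (2 * (x * complex.Re z) + t * x ^+ 2).
    rewrite big_split /= -mulr_sumr -[X in 2 * X]mulr_suml xs0 mul0r mulr0
      add0r.
    by rewrite -mulr_sumr.
  rewrite expR_sum rmorph_prod q'E normr_prod -prodrXl.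
  apply: ler_prod => x _; rewrite exprn_ge0//=.
  rewrite -complex.add_Re2_Im2 complex.lecR; apply: le_trans (expR_ge1Dx _).
  rewrite -zt2; case: z {zt zt2} => a b /=.
  rewrite le_eqVlt; apply/orP; left; apply/eqP; ring.
have := cauchy_coef_estimate _ q' _ _ _ qB j.
rewrite coef_map /= complex.ler0c sqrtr_ge0 => /(_ isT) h.
have {}h : `|q`_j| * Num.sqrt t ^+ j <= expR (t * s / 2).
  rewrite -complex.lecR; apply: le_trans h; rewrite rmorphM rmorphXn /=.
  apply: ler_wpM2r; first by rewrite exprn_ge0// complex.ler0c sqrtr_ge0.
  rewrite complex.normc_def /= expr0n /= addr0 sqrtr_sqr lexx//.
have -> : expR (t * s) = expR (t * s / 2) ^+ 2.
  by rewrite -expRM_natl; congr expR; field.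
have -> : q`_j ^+ 2 * t ^+ j = (`|q`_j| * Num.sqrt t ^+ j) ^+ 2.
  by rewrite exprMn real_normK ?num_real// -exprM mulnC exprM sqr_sqrtr.
rewrite ler_pXn2r// nnegrE ?expR_ge0// mulr_ge0// exprn_ge0// sqrtr_ge0//.
Qed.

End coefficient_estimate.

Lemma coef0_mul1DZX (R : nzRingType) (x : R) (B : {poly R}) :
  ((1 + x *: 'X) * B)`_0 = B`_0.
Proof. by rewrite mulrDl mul1r -scalerAl coefD coefZ coefXM mulr0 addr0. Qed.

Lemma coefS_mul1DZX (R : nzRingType) (x : R) (B : {poly R}) k :
  ((1 + x *: 'X) * B)`_k.+1 = B`_k.+1 + x * B`_k.
Proof. by rewrite mulrDl mul1r -scalerAl coefD coefZ coefXM. Qed.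

(** Newton's identities by induction on the list: a new entry [x] adds [x ^ k] to the power sums and
    multiplies [q] by [1 + x *: 'X]. *)
Lemma newton_girard4 (R : numFieldType) (xs : seq R) :
  let q := \prod_(x <- xs) (1 + x *: 'X) in
  let s k := \sum_(x <- xs) x ^+ k in
  [/\ q`_0 = 1, q`_1 = s 1, q`_2 = (s 1 ^+ 2 - s 2) / 2,
      q`_3 = (s 1 ^+ 3 - 3 * s 1 * s 2 + 2 * s 3) / 6 &
      q`_4 = (s 1 ^+ 4 - 6 * s 1 ^+ 2 * s 2 + 3 * s 2 ^+ 2
              + 8 * s 1 * s 3 - 6 * s 4) / 24].
Proof.
rewrite /=; elim: xs => [|x xs [q0 q1 q2 q3 q4]].
  by rewrite !big_nil !coef1 /=; split; field.
by rewrite !big_cons !coef0_mul1DZX !coefS_mul1DZX q0 q1 q2 q3 q4; split; field.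
Qed.

(** * Numerical bounds on [e] and the coefficient estimate with constant [c1] *)

Section coefficient_bound.
Context {R : realType}.
Implicit Types (xs : seq R) (c : R).
Local Notation e := (expR 1 : R).
Local Notation c1 := (Num.sqrt e - 1).

(** Both sides come from powers of [1 + x <= expR x], taken at [x = 1 / 12] and [x = - 1 / 20]. *)
Lemma expR1_bounds : 26 / 10 <= e <= 28 / 10.
Proof.
apply/andP; split.
  have h : (1 + 12^-1) ^+ 12 <= e.
    have -> : e = expR 12^-1 ^+ 12 by rewrite -expRM_natl divff ?pnatr_eq0.
    by rewrite lerXn2r ?nnegrE ?expR_ge0// ?expR_ge1Dx// addr_ge0.
  by apply: le_trans h; lra.
have h : (1 - 20^-1) ^+ 20 <= e^-1.
  have -> : e^-1 = expR (- 20^-1) ^+ 20.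
    by rewrite -expRM_natl mulrN divff ?pnatr_eq0// expRN.
  by rewrite lerXn2r ?nnegrE ?expR_ge0// ?expR_ge1Dx//; lra.
have {}h : (28 / 10)^-1 <= e^-1 by apply: le_trans h; lra.
by rewrite -lef_pV2// posrE// expR_gt0.
Qed.

Lemma sqrt_expR1_sub1_ge : 6 / 10 <= c1.
Proof.
have /andP[h _] := expR1_bounds.
rewrite lerBrDr -(@ler_pXn2r _ 2)// ?nnegrE ?sqrtr_ge0//.
by rewrite sqr_sqrtr ?expR_ge0//; lra.
Qed.

(** This is what Cauchy's estimate requires at its optimal radius. One induction step costs a factor
    at most [j * e], which [(1 - 1 / (j + 1)) ^ (j + 1) <= 1 / e] absorbs. The inequality already
    fails at [j = 4]. *)
Lemma fact_expR1_le j :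
  (5 <= j)%N -> (j - 2)`!%:R * e ^+ j <= c1 ^+ 2 * j%:R ^+ j.
Proof.
have /andP[e0 e1] := expR1_bounds; have c := sqrt_expR1_sub1_ge.
elim: j => // j IH; rewrite leq_eqVlt => /orP[/eqP<-|].
  have -> : (5 - 2)`!%:R = 6 :> R by [].
  have : e ^+ 5 <= (28 / 10) ^+ 5 by rewrite lerXn2r// nnegrE; lra.
  have : (6 / 10) ^+ 2 <= c1 ^+ 2 by rewrite lerXn2r// nnegrE; lra.
  by lra.
rewrite ltnS => j5; have {IH}h := IH j5.
have j0 : 0 < j%:R :> R by rewrite ltr0n; lia.
have -> : (j.+1 - 2)%N = (j - 2).+1 by lia.
have hj : e * j%:R ^+ j.+1 <= j.+1%:R ^+ j.+1.
  have h1 : (1 - j.+1%:R^-1) ^+ j.+1 <= e^-1.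
    have -> : e^-1 = expR (- j.+1%:R^-1) ^+ j.+1.
      by rewrite -expRM_natl mulrN divff ?pnatr_eq0// expRN.
    rewrite lerXn2r ?nnegrE ?expR_ge0// ?expR_ge1Dx//.
    by rewrite subr_ge0 invf_le1 ?ler1n// ltr0n.
  have {h1} : (j%:R / j.+1%:R) ^+ j.+1 <= e^-1.
    apply: le_trans h1; rewrite le_eqVlt; apply/orP; left; apply/eqP.
    congr (_ ^+ _); rewrite -natr1; field.
    by rewrite natr1 pnatr_eq0.
  rewrite expr_div_n ler_pdivrMr ?exprn_gt0 ?ltr0n// mulrC ler_pdivlMr
    ?expR_gt0//.
  by rewrite mulrC.
rewrite factS natrM exprS.
apply: (@le_trans _ _ (j%:R * e * (c1 ^+ 2 * j%:R ^+ j))).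
  rewrite mulrACA; apply: ler_pM; rewrite ?mulr_ge0 ?exprn_ge0 ?expR_ge0//.
  by rewrite ler_wpM2r ?expR_ge0// ler_nat; lia.
have -> : j%:R * e * (c1 ^+ 2 * j%:R ^+ j) = c1 ^+ 2 * (e * j%:R ^+ j.+1).
  by rewrite [j%:R * e]mulrC mulrCA (exprS j%:R) !mulrA.
by rewrite ler_wpM2l// sqr_ge0.
Qed.

(** Each [|x|] is at most the square root of the sum of squares. *)
Lemma sumXn_le_sum2 xs k :
  `|\sum_(x <- xs) x ^+ k.+2| <=
  (\sum_(x <- xs) x ^+ 2) * Num.sqrt (\sum_(x <- xs) x ^+ 2) ^+ k.
Proof.
set s := \sum_(x <- xs) x ^+ 2; apply: le_trans (ler_norm_sum _ _ _) _.
rewrite {1}/s mulr_suml big_seq [leRHS]big_seq; apply: ler_sum => x xxs.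
rewrite -addn2 addnC exprD normrM normrX real_normK ?num_real// ler_wpM2l
  ?sqr_ge0//.
rewrite normrX lerXn2r ?nnegrE ?sqrtr_ge0//.
rewrite -sqrtr_sqr; apply: ler_wsqrtr; rewrite /s (big_rem x xxs) /= lerDl.
by apply: sumr_ge0 => y _; rewrite sqr_ge0.
Qed.

Lemma prod_1Dx_coef_bound xs j :
  0 < \sum_(x <- xs) x ^+ 2 -> \sum_(x <- xs) x = 0 ->
  (\prod_(x <- xs) (1 + x *: 'X))`_j.+2 ^+ 2 <=
  c1 ^+ 2 * (\sum_(x <- xs) x ^+ 2) ^+ j.+2 / j`!%:R.
Proof.
set s := \sum_(x <- xs) x ^+ 2 => s0 xs0; set q := \prod_(x <- xs) _.
have c := sqrt_expR1_sub1_ge.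
have c36 : 36 / 100 <= c1 ^+ 2.
  have -> : 36 / 100 = (6 / 10) ^+ 2 :> R by field.
  by rewrite lerXn2r// nnegrE; lra.
have [_ _ q2 q3 q4] := newton_girard4 _ xs.
move: q2 q3 q4; rewrite -/q /= -/s.
have -> : \sum_(x <- xs) x ^+ 1 = 0 by rewrite -[RHS]xs0; apply: eq_bigr.
have := sumXn_le_sum2 xs 1; have := sumXn_le_sum2 xs 2; rewrite /= -/s.
set s3 := \sum_(x <- xs) x ^+ 3; set s4 := \sum_(x <- xs) x ^+ 4.
have u2 : Num.sqrt s ^+ 2 = s by rewrite sqr_sqrtr// ltW.
have u0 : 0 < Num.sqrt s by rewrite sqrtr_gt0.
move: (Num.sqrt s) u2 u0 => u u2 u0.
rewrite expr1 u2 => s4s s3s.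
rewrite !expr0n /= !(mulr0, mul0r, addr0, subr0, oppr0, add0r) => q2 q3 q4.
(* The first power sum vanishes, so the three lowest coefficients are [- s / 2], [s3 / 3] and
   [s ^ 2 / 8 - s4 / 4], with [|s3| ^ 2 <= s ^ 3] and [0 <= s4 <= s ^ 2]. Their squares are at most
   [s ^ 2 / 4], [s ^ 3 / 9] and [s ^ 4 / 64], for which [36 / 100 <= c1 ^ 2] is enough. *)
case: j => [|[|[|j]]].
- rewrite q2 divr1 exprMn sqrrN exprVn.
  by rewrite mulrC ler_wpM2r ?sqr_ge0//; lra.
- rewrite q3 divr1; apply: (@le_trans _ _ (s3 ^+ 2 / 9)); first by lra.
  have : `|s3| ^+ 2 <= (s * u) ^+ 2 by rewrite lerXn2r// nnegrE mulr_ge0 ?ltW.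
  rewrite real_normK ?num_real// exprMn u2 -exprSr => h.
  have : 36 / 100 * s ^+ 3 <= c1 ^+ 2 * s ^+ 3 by rewrite ler_wpM2r//
    exprn_ge0// ltW.
  have : 0 < s ^+ 3 by rewrite exprn_gt0.
  by lra.
- rewrite q4.
  have s40 : 0 <= s4 by apply: sumr_ge0 => x _; rewrite exprn_even_ge0.
  rewrite ger0_norm// in s4s.
  have h : ((3 * s ^+ 2 - 6 * s4) / 24) ^+ 2 <= (s ^+ 2 / 8) ^+ 2.
    rewrite -ler_sqrt ?sqr_ge0// !sqrtr_sqr [leRHS]ger0_norm ?divr_ge0
      ?sqr_ge0//.
    by rewrite ler_norml; lra.
  apply: (le_trans h); rewrite -[2`!]/2%N.
  have : 36 / 100 * s ^+ 4 <= c1 ^+ 2 * s ^+ 4 by rewrite ler_wpM2r//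
    exprn_ge0// ltW.
  have : 0 < s ^+ 4 by rewrite exprn_gt0.
  by lra.
(* The squared radius [t = k / s] minimises [exp (t s) / t ^ k]. *)
set k := j.+3.+2.
have t0 : 0 <= k%:R / s by rewrite divr_ge0// ltW.
have := @prod_1Dx_coef_sqr_le _ xs (k%:R / s) k t0 xs0.
rewrite -/q -/s divfK ?gt_eqF// expr_div_n mulrA ler_pdivrMr ?exprn_gt0// => h.
have k0 : 0 < k%:R ^+ k :> R by rewrite exprn_gt0// ltr0n.
have := @fact_expR1_le k isT; rewrite subn2 /= -expRM_natl mulr1 => h2.
rewrite ler_pdivlMr ?ltr0n ?fact_gt0// -(ler_pM2r k0) mulrAC.
apply: (@le_trans _ _ (expR k%:R * s ^+ k * (j.+3)`!%:R)).
  by rewrite ler_wpM2r.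
rewrite mulrAC [leRHS]mulrAC ler_pM2r ?exprn_gt0//.
by rewrite mulrC.
Qed.
End coefficient_bound.

(** * Charlier polynomials *)

Lemma partial_sum_le_lim {R : realType} (u : nat -> R) (l : R) M :
  (forall m, 0 <= u m) ->
  (fun M => \sum_(0 <= m < M) u m) @ \oo --> l -> \sum_(0 <= m < M) u m <= l.
Proof.
move=> u0 ul; apply: (cvgr_to_ge ul); near=> K.
have MK : (M <= K)%N by near: K; exact: nbhs_infty_ge.
by rewrite [leRHS](big_cat_nat _ MK)//= lerDl; apply: sumr_ge0.
Unshelve. all: by end_near. Qed.

Section poisson_charlier.
Context {R : realType}.
Variable lambda : R.
Hypothesis lambda_gt0 : 0 < lambda.
Implicit Types (f g : nat -> R) (B : {poly R}).

Definition poisson_weight (m : nat) : R :=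
  expR (- lambda) * (lambda ^+ m / m`!%:R).
Local Notation po := poisson_weight.

Lemma poisson_weight_gt0 m : 0 < po m.
Proof. by rewrite mulr_gt0 ?expR_gt0// divr_gt0 ?exprn_gt0// ltr0n fact_gt0.
  Qed.

Lemma poisson_weightS m : po m.+1 * m.+1%:R = lambda * po m.
Proof.
rewrite /po factS natrM exprS; field.
by rewrite pnatr_eq0 -lt0n fact_gt0 addrC natr1 pnatr_eq0.
Qed.

(** Expectation as a relation: convergence of the series and its value are established together, for
    functions of any sign. *)
Definition poisson_mean f (v : R) : Prop :=
  (fun M => \sum_(0 <= m < M) po m * f m) @ \oo --> v.

Lemma poisson_mean1 : poisson_mean (fun=> 1) 1.
Proof.
rewrite /poisson_mean.
have -> : (fun M => \sum_(0 <= m < M) po m * 1) =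
    (fun M => expR (- lambda) * series (exp_coeff lambda) M).
  apply/funext => M; rewrite /series /= mulr_sumr; apply: eq_bigr => m _.
  by rewrite mulr1.
have -> : 1 = expR (- lambda) * expR lambda :> R.
  by rewrite mulrC expRxMexpNx_1.
by apply: cvgMl_tmp; exact: is_cvg_series_exp_coeff.
Qed.

Lemma eq_poisson_mean f g v : f =1 g -> poisson_mean f v -> poisson_mean g v.
Proof. by move=> /funext ->. Qed.

Lemma poisson_meanD f g v w : poisson_mean f v -> poisson_mean g w ->
  poisson_mean (fun m => f m + g m) (v + w).
Proof.
move=> fv gw; rewrite /poisson_mean;
  under eq_fun do under eq_bigr do rewrite mulrDr.
under eq_fun do rewrite big_split.
exact: cvgD.
Qed.

Lemma poisson_meanZ a f v : poisson_mean f v ->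
  poisson_mean (fun m => a * f m) (a * v).
Proof.
move=> fv; rewrite /poisson_mean;
  under eq_fun do under eq_bigr do rewrite mulrCA.
under eq_fun do rewrite -mulr_sumr.
exact: cvgMl_tmp.
Qed.

Lemma poisson_mean_sum N (f : nat -> nat -> R) (v : nat -> R) :
  (forall i, poisson_mean (f i) (v i)) ->
  poisson_mean (fun m => \sum_(i < N) f i m) (\sum_(i < N) v i).
Proof.
move=> fv; elim: N => [|N IH].
  rewrite big_ord0 -(mul0r 1);
    apply: eq_poisson_mean (poisson_meanZ 0 _ _ poisson_mean1).
  by move=> m; rewrite big_ord0 mul0r.
rewrite big_ord_recr /=;
  apply: eq_poisson_mean (poisson_meanD _ _ _ _ IH (fv N)).
by move=> m; rewrite big_ord_recr.
Qed.

(** The Stein-Chen identity. The term at [m = 0] vanishes, and [poisson_weightS] shifts the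
    remaining ones. *)
Lemma poisson_mean_stein f v : poisson_mean (fun m => f m.+1) v ->
  poisson_mean (fun m => m%:R * f m) (lambda * v).
Proof.
move=> fv; rewrite /poisson_mean -cvg_shiftS.
have -> : [sequence \sum_(0 <= m < n.+1) po m * (m%:R * f m)]_n =
    (fun n => lambda * \sum_(0 <= m < n) po m * f m.+1).
  apply/funext => n /=; rewrite big_nat_recl// mul0r mulr0 add0r mulr_sumr.
  by apply: eq_bigr => m _; rewrite mulrA poisson_weightS mulrA.
exact: cvgMl_tmp.
Qed.

(** Charlier polynomials, normalised so that [po m * charlier j m] is the coefficient of [z ^ m] in
    [exp (lambda (z - 1)) * (z - 1) ^ j]. The default [0.-1 = 0] is harmless, being multiplied by
    [m = 0]. *)
Fixpoint charlier (j m : nat) : R :=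
  if j is j'.+1 then m%:R / lambda * charlier j' m.-1 - charlier j' m else 1.

(** The forward difference is a lowering operator; paired with the raising recursion of [charlier]
    it yields orthogonality. *)
Lemma charlierS j m :
  charlier j.+1 m.+1 - charlier j.+1 m = j.+1%:R / lambda * charlier j m.
Proof.
have l0 : lambda != 0 by rewrite gt_eqF.
elim: j m => [|j IH] m.
  by rewrite /= -natr1; field.
have e1 : m%:R / lambda * charlier j.+1 m.-1 =
    m%:R / lambda * (charlier j.+1 m - j.+1%:R / lambda * charlier j m.-1).
  case: m => [|m]; first by rewrite !mul0r.
  by rewrite [m.+1.-1]/= -IH subKr.
have e2 : charlier j.+1 m =
  m%:R / lambda * charlier j m.-1 - charlier j m by [].
have -> : charlier j.+2 m.+1 =
  m.+1%:R / lambda * charlier j.+1 m - charlier j.+1 m.+1 by [].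
have -> : charlier j.+2 m =
  m%:R / lambda * charlier j.+1 m.-1 - charlier j.+1 m by [].
rewrite e1 -[charlier j.+1 m.+1](subrK (charlier j.+1 m)) IH.
rewrite -[j.+2%:R]natr1 -[m.+1%:R]natr1.
have -> : charlier j m = m%:R / lambda * charlier j m.-1 - charlier j.+1 m.
  by rewrite e2; ring.
by field.
Qed.

(** Summation by parts: the Stein identity makes the raising recursion adjoint to the forward
    difference of [g]. *)
Lemma poisson_mean_charlierS j g v w :
  poisson_mean (fun m => charlier j m * g m.+1) v ->
  poisson_mean (fun m => charlier j m * g m) w ->
  poisson_mean (fun m => charlier j.+1 m * g m) (v - w).
Proof.
move=> hv hw.
pose f m := charlier j m.-1 * g m / lambda.
have h : poisson_mean (fun m => m%:R * f m) v.
  have -> : v = lambda * (lambda^-1 * v) by rewrite mulVKf// gt_eqF.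
  apply: poisson_mean_stein; apply: eq_poisson_mean (poisson_meanZ _ _ _ hv).
  by move=> m; rewrite mulrC.
rewrite -mulN1r.
apply: eq_poisson_mean (poisson_meanD _ _ _ _ h (poisson_meanZ
  (-1) _ _ hw)) => m.
by rewrite /f /=; ring.
Qed.

(** Lowering [i] differentiates the other factor, which [charlierS] turns into [charlier] of index
    one less times [j.+1 / lambda]. These factors accumulate to the squared norm when the indices
    agree; otherwise a constant is eventually differenced to zero. *)
Lemma charlier_orthogonal i j :
  poisson_mean (fun m => charlier i m * charlier j m)
    (if i == j then j`!%:R / lambda ^+ j else 0).
Proof.
elim: i j => [|i IH] j.
  elim: j => [|j IH] /=.
    by rewrite divr1; apply: eq_poisson_mean poisson_mean1 => m; rewrite mulr1.
  rewrite -(subrr (if 0%N == j then j`!%:R / lambda ^+ j else 0)).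
  have h : poisson_mean (fun m =>
    charlier j m * 1) (if 0%N == j then j`!%:R / lambda ^+ j else 0).
    by apply: eq_poisson_mean IH => m; rewrite mulrC.
  apply: eq_poisson_mean (poisson_mean_charlierS _ _ _ _ h h) => m.
  by rewrite mulrC.
case: j => [|j].
  have -> : (if i.+1 == 0%N then 0`!%:R / lambda ^+ 0 else 0) =
      let u := if i == 0%N then 0`!%:R / lambda ^+ 0 else 0 in u - u.
    by rewrite /= subrr.
  exact: (poisson_mean_charlierS _ (charlier 0) _ _ (IH 0) (IH 0)).
rewrite eqSS.
set v := (if i == j then _ else _).
pose w := if i == j.+1 then j.+1`!%:R / lambda ^+ j.+1 else 0.
(* The minuend is the mean of [charlier i m * charlier j.+1 m.+1], and [w] is the mean without the
   shift. *)
have -> : v = w + j.+1%:R / lambda *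
  (if i == j then j`!%:R / lambda ^+ j else 0) - w.
  rewrite addrC addKr /v; case: eqP => _; last by rewrite mulr0.
  rewrite factS natrM exprS; field.
  by rewrite expf_neq0 ?gt_eqF.
apply: (poisson_mean_charlierS _ (charlier j.+1)); last exact: IH.
apply: eq_poisson_mean (poisson_meanD _ _ _ _ (IH j.+1) (poisson_meanZ _ _ _
  (IH j))) => m.
by rewrite -[charlier j.+1 m.+1](subrK (charlier j.+1 m)) charlierS; ring.
Qed.

Definition charlier_sum B m : R := \sum_(j < size B) B`_j * charlier j m.

Definition charlier_norm2 B : R :=
  \sum_(j < size B) j`!%:R / lambda ^+ j * B`_j ^+ 2.

Lemma charlier_sum_wide K B m : (size B <= K)%N ->
  charlier_sum B m = \sum_(j < K) B`_j * charlier j m.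
Proof.
move=> BK; rewrite /charlier_sum (big_ord_widen _ (fun j =>
  B`_j * charlier j m) BK).
rewrite big_mkcond; apply: eq_bigr => j _; case: ltnP => // Bj.
by rewrite nth_default// mul0r.
Qed.

Lemma charlier_norm2_wide K B : (size B <= K)%N ->
  charlier_norm2 B = \sum_(j < K) j`!%:R / lambda ^+ j * B`_j ^+ 2.
Proof.
move=> BK; rewrite /charlier_norm2.
rewrite (big_ord_widen _ (fun j => j`!%:R / lambda ^+ j * B`_j ^+ 2) BK).
rewrite big_mkcond; apply: eq_bigr => j _; case: ltnP => // Bj.
by rewrite nth_default// expr0n mulr0.
Qed.

(** The square expands into a finite double sum, so linearity of the mean suffices, and
    orthogonality leaves the diagonal. *)
Lemma charlier_parseval B :
  poisson_mean (fun m => charlier_sum B m ^+ 2) (charlier_norm2 B).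
Proof.
have h i : poisson_mean
    (fun m => \sum_(j < size B) B`_i * B`_j * (charlier i m * charlier j m))
    (\sum_(j < size B) B`_i * B`_j *
       (if i == j then j`!%:R / lambda ^+ j else 0)).
  apply: (poisson_mean_sum _ (fun j m =>
    B`_i * B`_j * (charlier i m * charlier j m))
    (fun j => B`_i * B`_j * (if i == j then j`!%:R / lambda ^+ j else 0))) => j.
  exact/poisson_meanZ/charlier_orthogonal.
have -> : charlier_norm2 B = \sum_(i < size B) \sum_(j < size B) B`_i * B`_j *
       (if (i : nat) == j then j`!%:R / lambda ^+ j else 0).
  apply: eq_bigr => i _; rewrite (bigD1 i)//= eqxx big1 ?addr0.
    by rewrite mulrC expr2.
  by move=> j; rewrite -val_eqE /= eq_sym => /negbTE ->; rewrite mulr0.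
apply: eq_poisson_mean (poisson_mean_sum (size B) _ _ h) => m.
rewrite expr2 /charlier_sum mulr_suml; apply: eq_bigr => i _.
by rewrite mulr_sumr; apply: eq_bigr => j _; rewrite mulrACA.
Qed.

Lemma charlier_sum_le_norm2 B M :
  \sum_(0 <= m < M) po m * charlier_sum B m ^+ 2 <= charlier_norm2 B.
Proof.
apply: partial_sum_le_lim (charlier_parseval B) => m.
by rewrite mulr_ge0 ?sqr_ge0// ltW// poisson_weight_gt0.
Qed.

(** Orthogonality to [charlier 0], the constant 1. *)
Lemma poisson_mean_charlier_sum B : poisson_mean (charlier_sum B) B`_0.
Proof.
have h := poisson_mean_sum (size B) _ _ (fun j =>
  poisson_meanZ B`_j _ _ (charlier_orthogonal 0 j)).
have e : \sum_(i < size B) B`_i *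
  (if 0%N == i then i`!%:R / lambda ^+ i else 0) = B`_0.
  case: (size B) (@nth_default _ (0 : R) B 0) => [|K] d.
    by rewrite big_ord0 d.
  by rewrite big_ord_recl /= divr1 mulr1 big1 ?addr0// => i _; rewrite mulr0.
rewrite -e; apply: eq_poisson_mean h => m; apply: eq_bigr => j _.
by rewrite mul1r.
Qed.

(* The coefficient of [z ^ m] in [exp (lambda (z - 1)) * B (z - 1)]. *)
Definition charlier_coef B m : R := po m * charlier_sum B m.

Lemma charlier_sumD A B m : charlier_sum (A + B) m =
  charlier_sum A m + charlier_sum B m.
Proof.
set K := maxn (size A) (size B).
rewrite (charlier_sum_wide K) ?size_polyD// (charlier_sum_wide K A) ?leq_maxl//.
rewrite (charlier_sum_wide K B) ?leq_maxr//.
by rewrite -big_split; apply: eq_bigr => j _; rewrite coefD mulrDl.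
Qed.

Lemma charlier_sumZ a B m : charlier_sum (a *: B) m = a * charlier_sum B m.
Proof.
rewrite (charlier_sum_wide _ _ _ (size_scale_leq a B)) mulr_sumr.
by apply: eq_bigr => j _; rewrite coefZ mulrA.
Qed.

Lemma charlier_sumXM B m :
  charlier_sum ('X * B) m =
    m%:R / lambda * charlier_sum B m.-1 - charlier_sum B m.
Proof.
have sB : (size ('X * B)%R <= (size B).+1)%N.
  by rewrite (leq_trans (size_polyMleq _ _))// size_polyX.
rewrite (charlier_sum_wide _ _ _ sB) big_ord_recl coefXM /= mul0r add0r.
rewrite mulr_sumr -sumrB; apply: eq_bigr => j _.
by rewrite coefXM /=; ring.
Qed.

Lemma charlier_coefD A B m : charlier_coef (A + B) m =
  charlier_coef A m + charlier_coef B m.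
Proof. by rewrite /charlier_coef charlier_sumD mulrDr. Qed.

Lemma charlier_coefZ a B m : charlier_coef (a *: B) m = a * charlier_coef B m.
Proof. by rewrite /charlier_coef charlier_sumZ mulrCA. Qed.

Lemma charlier_coef1 m : charlier_coef 1 m = po m.
Proof.
by rewrite /charlier_coef /charlier_sum size_poly1 big_ord1 coef1 /= mul1r
  mulr1.
Qed.

Lemma charlier_coefXM B m : charlier_coef ('X * B) m =
  (if m is m'.+1 then charlier_coef B m' else 0) - charlier_coef B m.
Proof.
rewrite /charlier_coef charlier_sumXM mulrBr; congr (_ - _).
case: m => [|m]; first by rewrite !mul0r mulr0.
rewrite /= !mulrA poisson_weightS; field.
by rewrite gt_eqF.
Qed.

(** The differences of [charlier_coefXM] telescope; this passes from point masses to distribution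
    functions. *)
Lemma sum_charlier_coefXM B m :
  \sum_(0 <= k < m.+1) charlier_coef ('X * B) k = - charlier_coef B m.
Proof.
elim: m => [|m IH]; first by rewrite big_nat1 charlier_coefXM sub0r.
by rewrite big_nat_recr //= IH charlier_coefXM addrA addNr add0r.
Qed.

(** The sequence attached to ['X * B] has total sum equal to the constant coefficient 0, and its
    partial sums are the values in question up to sign. *)
Lemma charlier_coef_cvg0 B : charlier_coef B m @[m --> \oo] --> 0.
Proof.
have := poisson_mean_charlier_sum ('X * B); rewrite /poisson_mean coefXM /=.
rewrite -cvg_shiftS => /cvgN; rewrite oppr0; apply: cvg_trans.
apply: near_eq_cvg; near=> m => /=.
have /(congr1 -%R) := sum_charlier_coefXM B m; rewrite opprK => <-.
by [].
Unshelve. all: by end_near. Qed.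

(** Cauchy-Schwarz, from the nonnegativity of the weighted variance of [g] around its mean
    [G / W]. *)
Lemma sqr_weighted_sum_le (s : seq nat) (w g : nat -> R) :
  (forall m, 0 < w m) ->
  (\sum_(m <- s) w m * g m) ^+ 2 <=
  (\sum_(m <- s) w m) * (\sum_(m <- s) w m * g m ^+ 2).
Proof.
move=> w0; set W := \sum_(m <- s) w m; set G := \sum_(m <- s) w m * g m.
case: s @W @G => [|a s] W G.
  by rewrite /W /G !big_nil expr0n mul0r.
have W0 : 0 < W.
  rewrite /W big_cons ltr_pwDl//; apply: sumr_ge0 => m _; exact: ltW.
have : 0 <= \sum_(m <- a :: s) w m * (g m - G / W) ^+ 2.
  by apply: sumr_ge0 => m _; rewrite mulr_ge0 ?sqr_ge0// ltW.
have -> : \sum_(m <- a :: s) w m * (g m - G / W) ^+ 2 =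
   \sum_(m <- a :: s) w m * g m ^+ 2 - G ^+ 2 / W.
  transitivity (\sum_(m <- a ::
    s) (w m * g m ^+ 2 - 2 * (G / W) * (w m * g m) + (G / W) ^+ 2 * w m)).
    by apply: eq_bigr => m _; ring.
  rewrite big_split sumrB /= -!mulr_sumr -/G -/W; field.
  by rewrite gt_eqF.
by rewrite subr_ge0 ler_pdivrMr// mulrC.
Qed.

Lemma charlier_coef_sqr_le B M :
  \sum_(0 <= m < M) charlier_coef B m ^+ 2 / po m <= charlier_norm2 B.
Proof.
apply: le_trans (charlier_sum_le_norm2 B M).
rewrite le_eqVlt; apply/orP; left; apply/eqP; apply: eq_bigr => m _.
by rewrite /charlier_coef; field; rewrite gt_eqF// poisson_weight_gt0.
Qed.

Lemma sum_charlier_coef_sqr_le B a b :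
  (\sum_(a <= m < b) charlier_coef B m) ^+ 2 <=
  (\sum_(a <= m < b) po m) * charlier_norm2 B.
Proof.
apply: le_trans (sqr_weighted_sum_le _ _ _ poisson_weight_gt0) _.
apply: ler_wpM2l.
  by apply: sumr_ge0 => m _; rewrite ltW// poisson_weight_gt0.
have [ab|ba] := leqP a b; last first.
  rewrite big_geq ?(ltnW ba)//; apply: sumr_ge0 => m _.
  by rewrite mulr_ge0 ?sqr_ge0// divr_ge0// exprn_ge0// ltW.
apply: le_trans (charlier_sum_le_norm2 B b).
rewrite [leRHS](big_cat_nat _ ab)//= lerDr.
by apply: sumr_ge0 => m _; rewrite mulr_ge0 ?sqr_ge0// ltW// poisson_weight_gt0.
Qed.

Lemma poisson_weight_sum_le1 M : \sum_(0 <= m < M) po m <= 1.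
Proof.
apply: partial_sum_le_lim => [m|]; first by rewrite ltW// poisson_weight_gt0.
have := poisson_mean1; rewrite /poisson_mean.
by under eq_fun do under eq_bigr do rewrite mulr1.
Qed.

(** The value at [m] is minus a partial sum of the sequence of ['X * B], so Cauchy-Schwarz brings in
    the Poisson mass of [[0, m]]. *)
Lemma charlier_coef_sqr_le_head B m :
  charlier_coef B m ^+ 2 <=
  charlier_norm2 ('X * B) * \sum_(0 <= k < m.+1) po k.
Proof.
rewrite -sqrrN -sum_charlier_coefXM [leRHS]mulrC.
exact: sum_charlier_coef_sqr_le.
Qed.

(** The same over the window from [m.+1] to [M], as [M] tends to infinity: the value at [M] tends to
    0, and the mass of the window is at most that of the tail. *)
Lemma charlier_coef_sqr_le_tail B m :
  charlier_coef B m ^+ 2 <=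
  charlier_norm2 ('X * B) * (1 - \sum_(0 <= k < m.+1) po k).
Proof.
have N0 : 0 <= charlier_norm2 ('X * B).
  apply: sumr_ge0 => j _.
  by rewrite mulr_ge0 ?sqr_ge0// divr_ge0// exprn_ge0// ltW.
have h : (fun M => (charlier_coef B m - charlier_coef B M) ^+ 2) @ \oo -->
    charlier_coef B m ^+ 2.
  have h1 : (fun M => charlier_coef B m - charlier_coef B M) @ \oo -->
    charlier_coef B m - 0.
    by apply: cvgB; [exact: cvg_cst | exact: charlier_coef_cvg0].
  rewrite subr0 in h1; rewrite expr2; under eq_fun do rewrite expr2.
  exact: cvgM.
apply: (cvgr_to_le h); near=> M.
have mM : (m.+1 <= M.+1)%N by near: M; exact: nbhs_infty_ge.
have -> : charlier_coef B m - charlier_coef B M =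
    \sum_(m.+1 <= k < M.+1) charlier_coef ('X * B) k.
  have := sum_charlier_coefXM B M; rewrite (big_cat_nat _ mM)//=.
  by rewrite sum_charlier_coefXM => /eqP; rewrite addrC subr_eq => /eqP ->;
    rewrite addrC.
apply: le_trans (sum_charlier_coef_sqr_le _ _ _) _.
rewrite mulrC ler_wpM2l// lerBrDl.
rewrite -(big_cat_nat _ mM)//=; exact: poisson_weight_sum_le1.
Unshelve. all: by end_near. Qed.

End poisson_charlier.

(** * Bounds on Charlier norms and the Poisson limit *)

Lemma cvg_exprn {R : realFieldType} (u : nat -> R) (l : R) j :
  u @ \oo --> l -> u k ^+ j @[k --> \oo] --> l ^+ j.
Proof.
move=> ul; elim: j => [|j IH]; first exact: cvg_cst.
by rewrite exprS; under eq_fun do rewrite exprS; exact: cvgM.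
Qed.

Lemma cvg_sum_ord {R : realFieldType} K (f : nat -> nat -> R) (l : nat -> R) :
  (forall i, f i N @[N --> \oo] --> l i) ->
  \sum_(i < K) f i N @[N --> \oo] --> \sum_(i < K) l i.
Proof.
move=> fl; elim: K => [|K IH].
  by rewrite big_ord0; under eq_fun do rewrite big_ord0; exact: cvg_cst.
rewrite big_ord_recr /=; under eq_fun do rewrite big_ord_recr /=.
exact: cvgD.
Qed.

(** Negative binomial series: by Pascal's rule, multiplying by [1 - t] lowers [r] up to a boundary
    term of favourable sign. *)
Lemma sum_bin_geometric_le {R : realFieldType} (t : R) r K : 0 <= t < 1 ->
  \sum_(i < K) 'C(i + r, r)%:R * t ^+ i <= (1 - t) ^- r.+1.
Proof.
move=> /andP[t0 t1]; have u0 : 0 < 1 - t by rewrite subr_gt0.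
elim: r => [|r IH].
  rewrite -[leRHS]mul1r ler_pdivlMr// mulrC expr1.
  under eq_bigr do rewrite bin0 mul1r.
  rewrite -opprB mulNr -subrX1 opprB gerBl exprn_ge0//.
have e : (1 - t) * (\sum_(i < K) 'C(i + r.+1, r.+1)%:R * t ^+ i) =
    \sum_(i < K) 'C(i + r, r)%:R * t ^+ i - 'C(K + r, r.+1)%:R * t ^+ K.
  elim: K {IH} => [|K IH].
    by rewrite !big_ord0 mulr0 add0n bin_small// mul0r subr0.
  rewrite !big_ord_recr /= mulrDr IH addSn addnS binS natrD exprS; ring.
rewrite exprS invfM [leRHS]mulrC ler_pdivlMr// mulrC e.
by apply: le_trans IH; rewrite gerBl mulr_ge0// exprn_ge0.
Qed.

Section charlier_norm_bound.
Context {R : realType}.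
Variable lambda : R.
Hypothesis lambda_gt0 : 0 < lambda.

(** The index [r] counts the factors [w] multiplying [(A - 1) / w]: 0 for distribution functions in
    chi-square norm, 1 for point masses in that norm and for pointwise distribution functions, 2 for
    pointwise masses. *)
Definition charlier_norm2_bound (c t : R) r : R :=
  r.+1`!%:R * c * t ^+ 2 * lambda / lambda ^+ r / (1 - t) ^+ r.+2.

(** The factorial weight divided by [i!] is [(r + 1)!] times a binomial coefficient, and the powers
    of [lambda] leave [t ^ i], so a negative binomial series remains. *)
Lemma charlier_norm2_XnM_le (G : {poly R}) (c t : R) r : 0 <= t < 1 -> 0 <= c ->
  G`_0 = 0 ->
  (forall i, G`_i.+1 ^+ 2 <= c * (t * lambda) ^+ i.+2 / i`!%:R) ->
  charlier_norm2 lambda ('X^r * G) <= charlier_norm2_bound c t r.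
Proof.
move=> t01 c0 G0 GS; have /andP[t0 t1] := t01.
have sG : (size ('X^r * G)%R <= r + (size G).+1)%N.
  by rewrite (leq_trans (size_polyMleq _ _))// size_polyXn addSn addnS leqW.
rewrite (charlier_norm2_wide _ _ _ sG) big_split_ord /= big1 ?add0r; last first.
  by move=> i _; rewrite coefXnM ltn_ord expr0n mulr0.
rewrite big_ord_recl /= coefXnM addn0 ltnn subnn G0 expr0n mulr0 add0r.
pose a := r.+1`!%:R * c * t ^+ 2 * lambda / lambda ^+ r.
have a0 : 0 <= a.
  by rewrite /a !mulr_ge0// ?sqr_ge0// ?invr_ge0 ?exprn_ge0 ?ltW.
apply: (@le_trans _ _
  (a * \sum_(i < size G) 'C(i + r.+1, r.+1)%:R * t ^+ i)); last first.
  by rewrite /charlier_norm2_bound ler_wpM2l// sum_bin_geometric_le.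
rewrite mulr_sumr; apply: ler_sum => i _.
rewrite coefXnM /bump /= add1n ltnNge leq_addr /= addKn.
have l0 : lambda != 0 by rewrite gt_eqF.
apply: (@le_trans _ _ ((r + i.+1)`!%:R / lambda ^+ (r + i.+1) *
    (c * (t * lambda) ^+ i.+2 / i`!%:R))).
  by rewrite ler_wpM2l// divr_ge0// exprn_ge0// ltW.
have -> : (r + i.+1)%N = (i + r.+1)%N by rewrite addnS addnC addnS.
have -> : (i + r.+1)`!%:R = 'C(i + r.+1, r.+1)%:R * (r.+1`!%:R * i`!%:R) :> R.
  by rewrite -!natrM -(bin_fact (leq_addl i r.+1)) addnK.
rewrite le_eqVlt; apply/orP; left; apply/eqP.
rewrite /a exprMn exprD !exprS.
have : i`!%:R != 0 :> R by rewrite pnatr_eq0 -lt0n fact_gt0.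
have : lambda ^+ i != 0 by rewrite expf_neq0.
have : lambda ^+ r != 0 by rewrite expf_neq0.
move: i`!%:R r.+1`!%:R 'C(_, _)%:R (lambda ^+ i) (lambda ^+ r) (t ^+ i).
move=> x1 x2 x3 x4 x5 x6 h5 h4 h1. field.
by rewrite h5 h4 h1 l0.
Qed.

Lemma charlier_norm2_bound_cvg (c t : R) (tn : nat -> R) r : t < 1 ->
  tn @ \oo --> t ->
  charlier_norm2_bound c (tn k) r @[k --> \oo] --> charlier_norm2_bound c t r.
Proof.
move=> t1 tnt; have u0 : (1 - t) ^+ r.+2 != 0.
  by rewrite expf_neq0// gt_eqF// subr_gt0.
apply: cvgM; last first.
  by apply: cvgV => //; apply: cvg_exprn; apply: cvgB => //; exact: cvg_cst.
apply: cvgMr_tmp; apply: cvgMr_tmp; apply: cvgMl_tmp; exact: cvg_exprn.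
Qed.

End charlier_norm_bound.

(** * Polynomial approximation of the exponential factor *)

Section poisson_limit.
Context {R : realType}.
Variable lambda : R.
Hypothesis lambda_gt0 : 0 < lambda.
Local Notation po := (poisson_weight lambda).
Local Notation H := (charlier_coef lambda).

Let a (N : nat) : R := lambda / N.+1%:R.

Lemma cvg_div_natS : a N @[N --> \oo] --> 0.
Proof.
by rewrite -(mulr0 lambda); apply: cvgMl_tmp; exact: cvg_harmonic.
Qed.

(** Squeeze, using [exp (a / (1 + a)) <= 1 + a <= exp a]; the left inequality is [1 + x <= expR x]
    at [x = - a / (1 + a)], inverted. *)
Lemma cvg_exp_1Ddiv : (1 + a N) ^+ N.+1 @[N --> \oo] --> expR lambda.
Proof.
have aE N : N.+1%:R * a N = lambda by rewrite /a mulrC divfK// pnatr_eq0.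
have a0 N : 0 < a N by rewrite divr_gt0// ltr0n.
apply: (@squeeze_cvgr _ _ _ _ (fun N => expR (lambda / (1 + a N)))
    (fun=> expR lambda)); last exact: cvg_cst.
- near=> N; apply/andP; split; last first.
    rewrite -(aE N) expRM_natl lerXn2r ?nnegrE ?expR_ge0 ?expR_ge1Dx//.
    by rewrite addr_ge0// ltW.
  rewrite -{1}(aE N) -mulrA expRM_natl lerXn2r ?nnegrE ?expR_ge0//.
    by rewrite addr_ge0// ltW.
  have u0 : 0 < 1 + a N by rewrite addr_gt0.
  rewrite -[leRHS]invrK -[leLHS]invrK lef_pV2 ?posrE ?invr_gt0 ?expR_gt0//.
  rewrite -expRN; apply: le_trans (expR_ge1Dx _).
  by rewrite le_eqVlt; apply/orP; left; apply/eqP; field; rewrite gt_eqF.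
- have h : lambda / (1 + a N) @[N --> \oo] --> lambda.
    rewrite -[X in _ --> X]mulr1; apply: cvgMl_tmp;
      rewrite -[X in _ --> X]invr1.
    apply: cvgV; first exact: oner_neq0.
    by rewrite -[X in _ --> X]addr0; apply: cvgD;
      [exact: cvg_cst|exact: cvg_div_natS].
  by apply: (cvg_comp _ _ h); exact: continuous_expR.
Unshelve. all: by end_near. Qed.

Lemma cvg_bin_exp i : 'C(N.+1, i)%:R * a N ^+ i @[N --> \oo] -->
  lambda ^+ i / i`!%:R.
Proof.
elim: i => [|i IH].
  by under eq_fun do rewrite bin0 mulr1; rewrite divr1; exact: cvg_cst.
have h : 1 - i%:R * N.+1%:R^-1 @[N --> \oo] --> (1 : R).
  rewrite -[X in _ --> X]subr0; apply: cvgB; first exact: cvg_cst.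
  by rewrite -(mulr0 i%:R); apply: cvgMl_tmp; exact: cvg_harmonic.
have -> : lambda ^+ i.+1 / i.+1`!%:R =
    lambda ^+ i / i`!%:R * 1 * (lambda / i.+1%:R).
  have f0 : i`!%:R != 0 :> R by rewrite pnatr_eq0 -lt0n fact_gt0.
  have i0 : i.+1%:R != 0 :> R by rewrite pnatr_eq0.
  rewrite factS natrM exprS; move: i`!%:R i.+1%:R f0 i0 => x y x0 y0; field.
  by rewrite x0 y0.
have {}h : 'C(N.+1, i)%:R * a N ^+ i * (1 - i%:R * N.+1%:R^-1) *
    (lambda / i.+1%:R) @[N --> \oo] -->
    lambda ^+ i / i`!%:R * 1 * (lambda / i.+1%:R).
  by apply: cvgMr_tmp; apply: cvgM.
apply: cvg_trans h; apply: near_eq_cvg; near=> N.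
have iN : (i <= N.+1)%N by near: N; exists i => // k /= ik; exact: leqW.
have e : i.+1%:R * 'C(N.+1, i.+1)%:R = (N.+1%:R - i%:R) * 'C(N.+1, i)%:R :> R.
  by rewrite -natrB// -!natrM mul_bin_left.
have -> : 'C(N.+1, i.+1)%:R = (N.+1%:R - i%:R) * 'C(N.+1, i)%:R / i.+1%:R :> R.
  by rewrite -e mulrC mulKf// pnatr_eq0.
rewrite /a exprS; move: (_ ^+ i) => u.
have n1 : N.+1%:R != 0 :> R by rewrite pnatr_eq0.
have i1 : i.+1%:R != 0 :> R by rewrite pnatr_eq0.
move: n1 i1; move: N.+1%:R i.+1%:R => x y x0 y0 /=.
by field; rewrite x0 y0.
Unshelve. all: by end_near. Qed.

Lemma charlier_coef_mul1D (x : R) B m : H ((1 + x *: 'X) * B) m =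
  (1 - x) * H B m + x * (if m is m'.+1 then H B m' else 0).
Proof.
rewrite mulrDl mul1r -scalerAl charlier_coefD charlier_coefZ charlier_coefXM//.
by case: m => [|m]; ring.
Qed.

(** Since [1 + w = z], multiplying by its [k]-th power shifts the Poisson weights by [k]. *)
Lemma charlier_coef_exp1DX k m : H ((1 + 'X) ^+ k) m =
  if (k <= m)%N then po (m - k) else 0.
Proof.
elim: k m => [|k IH] m; first by rewrite expr0 charlier_coef1 subn0.
rewrite exprS -{1}[X in 1 + X](scale1r 'X) charlier_coef_mul1D subrr mul0r
  add0r mul1r.
by case: m => // m; rewrite IH ltnS subSS.
Qed.

Lemma charlier_coef_sum (I : Type) (s : seq I) (F : I -> {poly R}) m :
  H (\sum_(i <- s) F i) m = \sum_(i <- s) H (F i) m.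
Proof.
elim: s => [|i s IH].
  by rewrite !big_nil -(scale0r 1) charlier_coefZ mul0r.
by rewrite !big_cons charlier_coefD IH.
Qed.

(* [exp (lambda w) * (1 - lambda w / N) ^ N] tends to [1] coefficientwise. *)
Lemma charlier_coef_exp_cvg m :
  H ((1 + (- a N) *: 'X) ^+ N.+1) m @[N --> \oo] --> ((m == 0)%:R : R).
Proof.
(* The limit is recognised as the binomial expansion of [(lambda - lambda) ^ m / m!], that is, the
   coefficient of [z ^ m] in [exp (lambda z) * exp (- lambda z)]. *)
have -> : ((m == 0)%:R : R) = \sum_(i < m.+1)
    (-1) ^+ i * (lambda ^+ i / i`!%:R) * (expR lambda / 1 ^+ i) * po (m - i).
  transitivity ((lambda - lambda) ^+ m / m`!%:R).
    rewrite subrr expr0n; case: m => [|m]; first by rewrite divr1.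
    by rewrite mul0r.
  rewrite exprDn mulr_suml; apply: eq_bigr => i _.
  have im : (i <= m)%N by rewrite -ltnS.
  rewrite expr1n divr1 /po -mulr_natl -(bin_fact im) [(_ *
    (_ * _))%:R]natrM [(_`! * _)%:R]natrM [(- lambda) ^+ i]exprNn.
  have -> : expR lambda = (expR (- lambda))^-1 by rewrite -expRN opprK.
  have f1 : i`!%:R != 0 :> R by rewrite pnatr_eq0 -lt0n fact_gt0.
  have f2 : (m - i)`!%:R != 0 :> R by rewrite pnatr_eq0 -lt0n fact_gt0.
  have f3 : 'C(m, i)%:R != 0 :> R by rewrite pnatr_eq0 -lt0n bin_gt0.
  have f4 : expR (- lambda) != 0 by rewrite expR_eq0.
  move: i`!%:R (m - i)`!%:R 'C(m, i)%:R (expR _) f1 f2 f3 f4 =>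
    x y z e x0 y0 z0 e0.
  field.
  by rewrite x0 y0 z0 e0.
have h : \sum_(i < m.+1) (-1) ^+ i * ('C(N.+1, i)%:R * a N ^+ i) *
      ((1 + a N) ^+ N.+1 / (1 + a N) ^+ i) * po (m - i) @[N --> \oo] -->
    \sum_(i < m.+1)
    (-1) ^+ i * (lambda ^+ i / i`!%:R) * (expR lambda / 1 ^+ i) * po (m - i).
  apply: (cvg_sum_ord _ (fun i N => (-1) ^+ i * ('C(N.+1, i)%:R * a N ^+ i) *
      ((1 + a N) ^+ N.+1 / (1 + a N) ^+ i) * po (m - i))
    (fun i => (-1) ^+ i * (lambda ^+ i / i`!%:R) * (expR lambda / 1 ^+ i)
      * po (m - i))) => i.
  apply: cvgMr_tmp; apply: cvgM; first by apply: cvgMl_tmp; exact: cvg_bin_exp.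
  apply: cvgM; first exact: cvg_exp_1Ddiv.
  apply: cvgV; first by rewrite expr1n oner_neq0.
  apply: cvg_exprn; rewrite -[X in _ --> X]addr0.
  by apply: cvgD; [exact: cvg_cst | exact: cvg_div_natS].
apply: cvg_trans h; apply: near_eq_cvg; near=> N.
have mN : (m.+1 <= N.+2)%N by near: N; exists m => // k /= ik; rewrite ltnS;
  exact: leqW.
have aN0 : 1 + a N != 0.
  by rewrite gt_eqF// addr_gt0// divr_gt0.
(* In terms of [z] the base is [(1 + a) - a z]; its power is expanded in powers of [z], and only
   those with exponent at most [m] contribute. *)
have -> : 1 + - a N *: 'X = (1 + a N)%:P + (- a N) *: (1 + 'X) :> {poly R}.
  by rewrite scalerDr alg_polyC polyCD polyCN addrA addrK.
rewrite [((1 + a N)%:P + _) ^+ _]exprDn charlier_coef_sum (big_ord_widen _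
  (fun i => (-1) ^+ i * ('C(N.+1, i)%:R * a N ^+ i) *
      ((1 + a N) ^+ N.+1 / (1 + a N) ^+ i) * po (m - i)) mN) big_mkcond.
apply: eq_bigr => i _;
  rewrite -polyC_exp mul_polyC [(- a N *:
  _) ^+ i]exprZn scalerA -[X in H X m]scaler_nat scalerA.
rewrite charlier_coefZ charlier_coef_exp1DX ltnS.
case: ifP => im; last by rewrite mulr0.
have iN : (i <= N.+1)%N by rewrite -ltnS.
rewrite -[in (1 + a N) ^+ N.+1](subnK iN) exprD mulfK ?expf_neq0//.
rewrite [(- a N) ^+ i]exprNn; ring.
Unshelve. all: by end_near. Qed.
End poisson_limit.

(** * Comparison of the Poisson-binomial coefficients with Poisson weights *)

Section poisson_binomial.
Context {R : realType}.
Variable ps : seq R.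
Let lambda := \sum_(p <- ps) p.
Let theta := (\sum_(p <- ps) p ^+ 2) / lambda.
Hypothesis lambda_gt0 : 0 < lambda.
Hypothesis theta_lt1 : theta < 1.
Local Notation po := (poisson_weight lambda).
Local Notation H := (charlier_coef lambda).
Local Notation c1 := (Num.sqrt (expR 1) - 1 : R).
Local Notation bound := (charlier_norm2_bound lambda (c1 ^+ 2) theta).

(** Here ['X] stands for [z], whereas in [Q] and [G] below it stands for [w = z - 1]. *)
Definition poisson_binomial_gf : {poly R} :=
  \prod_(p <- ps) ((1 - p)%:P + p *: 'X).
Local Notation L := poisson_binomial_gf.

Let a (N : nat) : R := lambda / N.+1%:R.

(** The appended entries make the total sum zero, as the coefficient bound demands. *)
Let xs N := ps ++ nseq N.+1 (- a N).

Let Q N : {poly R} := \prod_(x <- xs N) (1 + x *: 'X).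

(** The quotient [(Q - 1) / w]. *)
Let G N : {poly R} := \poly_(i < size (Q N)) (Q N)`_i.+1.

(** The counterpart of [theta] for the enlarged list: its sum of squares divided by [lambda]. *)
Let t N := theta + a N.

Let aN N : N.+1%:R * a N = lambda.
Proof. by rewrite /a mulrC divfK// pnatr_eq0. Qed.

Let sum_xs N : \sum_(x <- xs N) x = 0.
Proof.
rewrite big_cat big_nseq iter_addr_0 -mulr_natl mulrN aN -/lambda.
exact: subrr.
Qed.

Let sum2_xs N : \sum_(x <- xs N) x ^+ 2 = t N * lambda.
Proof.
rewrite big_cat big_nseq iter_addr_0 -mulr_natl sqrrN expr2 mulrA aN mulrDl.
by rewrite divfK ?gt_eqF// [lambda * _]mulrC.
Qed.

Let theta_ge0 : 0 <= theta.
Proof.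
apply: divr_ge0; last exact: ltW.
by apply: sumr_ge0 => x _; rewrite sqr_ge0.
Qed.

Let t_gt0 N : 0 < t N.
Proof. by rewrite ltr_wpDl// divr_gt0// ltr0n. Qed.

Let coefG N i : (G N)`_i = (Q N)`_i.+1.
Proof.
rewrite coef_poly; case: ltnP => // h.
by rewrite nth_default// ltnW.
Qed.

Let Q_eq N : Q N = 1 + 'X * G N.
Proof.
have [q0 _ _ _ _] := newton_girard4 _ (xs N).
apply/polyP => -[|i]; rewrite coefD coef1 coefXM /=;
  first by rewrite addr0 -[RHS]q0.
by rewrite add0r coefG.
Qed.

Let norm2_le N r : t N < 1 ->
  charlier_norm2 lambda ('X^r * G N) <=
  charlier_norm2_bound lambda (c1 ^+ 2) (t N) r.
Proof.
move=> t1; apply: charlier_norm2_XnM_le => //.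
- by rewrite t1 ltW.
- exact: sqr_ge0.
- rewrite coefG; have [_ q1 _ _ _] := newton_girard4 _ (xs N).
  rewrite [LHS]q1 -[RHS](sum_xs N).
  by apply: eq_bigr => x _; rewrite expr1.
- move=> i; rewrite coefG -sum2_xs; apply: prod_1Dx_coef_bound;
  last exact: sum_xs.
  by rewrite sum2_xs mulr_gt0.
Qed.

(** A factor [1 + p w = (1 - p) + p z] acts on both sides by the same two-term recursion, so the
    limit propagates from the empty product, where it is [charlier_coef_exp_cvg]. *)
Let cvg_Q m : H (Q N) m @[N --> \oo] --> L`_m.
Proof.
have QE N : Q N = \prod_(p <- ps) (1 + p *: 'X) * (1 + (- a N) *: 'X) ^+ N.+1.
  by rewrite /Q big_cat big_nseq iter_mulr_1.
under eq_fun do rewrite QE.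
(* Only the list in the product shrinks during the induction; [lambda] and [a N] remain those of
   [ps]. *)
pose P (s : seq R) := forall m,
  H (\prod_(p <- s) (1 + p *: 'X) * (1 + (- a N) *: 'X) ^+ N.+1) m @[N -->
    \oo] -->
  (\prod_(p <- s) ((1 - p)%:P + p *: 'X))`_m.
suff : P ps by exact.
elim: (ps) => [|p s IH] {}m.
  under eq_fun do rewrite big_nil mul1r.
  by rewrite big_nil coef1; exact: charlier_coef_exp_cvg.
under eq_fun do rewrite big_cons -mulrA charlier_coef_mul1D//.
rewrite big_cons mulrDl mul_polyC -scalerAl coefD !coefZ coefXM.
apply: cvgD; first by apply: cvgMl_tmp; exact: IH.
apply: cvgMl_tmp; case: m => [|m]; [exact: cvg_cst | exact: IH].
Qed.

Let cvg_XG m : H ('X * G N) m @[N --> \oo] --> L`_m - po m.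
Proof.
have e N : H ('X * G N) m = H (Q N) m - po m.
  by rewrite Q_eq charlier_coefD charlier_coef1 addrC addKr.
under eq_fun do rewrite e.
by apply: cvgB; [exact: cvg_Q | exact: cvg_cst].
Qed.

Let cvg_G m : H (G N) m @[N --> \oo] --> - \sum_(0 <= k < m.+1) (L`_k - po k).
Proof.
have e N : H (G N) m = - \sum_(0 <= k < m.+1) H ('X * G N) k.
  by rewrite sum_charlier_coefXM// opprK.
under eq_fun do rewrite e big_mkord; rewrite big_mkord.
apply: cvgN; apply: (cvg_sum_ord _ (fun k N => H ('X * G N) k)
  (fun k => L`_k - po k)) => k.
exact: cvg_XG.
Qed.

Let t_lt1 : \forall N \near \oo, t N < 1.
Proof.
have h : t N @[N --> \oo] --> theta.
  rewrite -[X in _ --> X]addr0; apply: cvgD; first exact: cvg_cst.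
  exact: cvg_div_natS.
exact: cvgr_lt h _ theta_lt1.
Qed.

Let bound_cvg r :
  charlier_norm2_bound lambda (c1 ^+ 2) (t N) r @[N --> \oo] --> bound r.
Proof.
apply: charlier_norm2_bound_cvg => //.
rewrite -[X in _ --> X]addr0; apply: cvgD; first exact: cvg_cst.
exact: cvg_div_natS.
Qed.

Lemma poisson_binomial_chi2 M :
  \sum_(0 <= m < M) (L`_m - po m) ^+ 2 / po m <= bound 1.
Proof.
have h : \sum_(0 <= m < M) H ('X * G N) m ^+ 2 / po m @[N --> \oo] -->
    \sum_(0 <= m < M) (L`_m - po m) ^+ 2 / po m.
  rewrite big_mkord; under eq_fun do rewrite big_mkord.
  apply: (cvg_sum_ord _ (fun m N => H ('X * G N) m ^+ 2 / po m)
    (fun m => (L`_m - po m) ^+ 2 / po m)) => m.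
  by apply: cvgMr_tmp; exact/cvg_exprn/cvg_XG.
apply: (ler_cvg_to h (bound_cvg 1)); near=> N.
apply: le_trans (charlier_coef_sqr_le _ _ _ _) _ => //.
by rewrite -[X in X * G N]expr1; apply: norm2_le; near: N; exact: t_lt1.
Unshelve. all: by end_near. Qed.

Lemma poisson_binomial_cdf_chi2 M :
  \sum_(0 <= m < M) (\sum_(0 <= k < m.+1) (L`_k - po k)) ^+ 2 / po m <= bound 0.
Proof.
have h : \sum_(0 <= m < M) H (G N) m ^+ 2 / po m @[N --> \oo] -->
    \sum_(0 <= m < M) (\sum_(0 <= k < m.+1) (L`_k - po k)) ^+ 2 / po m.
  rewrite big_mkord; under eq_fun do rewrite big_mkord.
  apply: (cvg_sum_ord _ (fun m N => H (G N) m ^+ 2 / po m)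
    (fun m => (\sum_(0 <= k < m.+1) (L`_k - po k)) ^+ 2 / po m)) => m.
  by rewrite -sqrrN; apply: cvgMr_tmp; exact/cvg_exprn/cvg_G.
apply: (ler_cvg_to h (bound_cvg 0)); near=> N.
apply: le_trans (charlier_coef_sqr_le _ _ _ _) _ => //.
by rewrite -[X in charlier_norm2 _ X]mul1r -(expr0 'X); apply: norm2_le;
  near: N; exact: t_lt1.
Unshelve. all: by end_near. Qed.

Local Notation Zm m := (Num.min (\sum_(0 <= k < m.+1) po k)
  (1 - \sum_(0 <= k < m.+1) po k)).

Let sqr_le_min (B : {poly R}) m :
  H B m ^+ 2 <= charlier_norm2 lambda ('X * B) * Zm m.
Proof.
by rewrite minElt; case: ifP => _;
  [exact: charlier_coef_sqr_le_head|exact: charlier_coef_sqr_le_tail].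
Qed.

Let Zm_ge0 m : 0 <= Zm m.
Proof.
rewrite le_min subr_ge0 poisson_weight_sum_le1// andbT.
by apply: sumr_ge0 => k _; rewrite ltW// poisson_weight_gt0.
Qed.

Lemma poisson_binomial_cdf_sqr_le m :
  (\sum_(0 <= k < m.+1) (L`_k - po k)) ^+ 2 <= bound 1 * Zm m.
Proof.
have h := cvg_exprn _ _ 2 (cvg_G m); rewrite sqrrN in h.
have h2 : charlier_norm2_bound lambda (c1 ^+ 2) (t N) 1 * Zm m @[N -->
  \oo] --> bound 1 * Zm m.
  by apply: cvgMr_tmp; exact: bound_cvg.
apply: (ler_cvg_to h h2); near=> N.
apply: (le_trans (sqr_le_min _ _)); rewrite ler_wpM2r//.
by rewrite -[X in X * G N]expr1; apply: norm2_le; near: N; exact: t_lt1.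
Unshelve. all: by end_near. Qed.

Lemma poisson_binomial_pmf_sqr_le m : (L`_m - po m) ^+ 2 <= bound 2 * Zm m.
Proof.
have h := cvg_exprn _ _ 2 (cvg_XG m).
have h2 : charlier_norm2_bound lambda (c1 ^+ 2) (t N) 2 * Zm m @[N -->
  \oo] --> bound 2 * Zm m.
  by apply: cvgMr_tmp; exact: bound_cvg.
apply: (ler_cvg_to h h2); near=> N.
apply: (le_trans (sqr_le_min _ _)); rewrite ler_wpM2r//.
by rewrite mulrA -expr2; apply: norm2_le; near: N; exact: t_lt1.
Unshelve. all: by end_near. Qed.

End poisson_binomial.

(** * Sums of independent Bernoulli variables *)

(** Expanding the product, [J] collects the factors that contribute their term in ['X]. *)
Lemma coef_prod_bernoulli_gf {R : comNzRingType} n (p : 'I_n -> R) m :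
  (\prod_(j < n) ((1 - p j)%:P + p j *: 'X))`_m =
  \sum_(J : {set 'I_n} | #|J| == m) \prod_j (if j \in J then p j else 1 - p j).
Proof.
under eq_bigr do rewrite addrC.
rewrite bigA_distr coef_sum [RHS]big_mkcond; apply: eq_bigr => J _.
have -> : \prod_j (if j \in J then p j *: 'X else (1 - p j)%:P) =
    (\prod_j (if j \in J then p j else 1 - p j)) *: 'X^#|J|.
  have -> : #|J| = (\sum_j (j \in J))%N by rewrite -sum1_card big_mkcond.
  rewrite expr_sum -scaler_prod; apply: eq_bigr => j _.
  by case: (j \in J); rewrite ?expr0 ?alg_polyC.
by rewrite coefZ coefXn eq_sym; case: eqP => _; rewrite ?mulr1 ?mulr0.
Qed.

Section bernoulli_sum.
Context {R : realType} {d : measure_display} {T : measurableType d}.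
Variables (P : probability T R) (n : nat) (X : 'I_n -> {RV P >-> R}).
Variable p : 'I_n -> R.
Hypothesis X_indep : mutually_independent X.
Hypothesis X_bernoulli : forall j, is_bernoulli (X j) (p j).
Let S w := \sum_(j < n) X j w.

Let weight (J : {set 'I_n}) := \prod_j (if j \in J then p j else 1 - p j).

(** The event that exactly the variables indexed by [J] equal 1 and the others equal 0. *)
Let atom (J : {set 'I_n}) : set T :=
  \bigcap_(j in [set` [set: 'I_n]%SET]) (X j @^-1` [set (j \in J)%:R]).

Let measurable_atom J : measurable (atom J).
Proof.
apply: fin_bigcap_measurable => [|j _]; first exact: finite_finset.
by rewrite -[_ @^-1` _]setTI; exact: measurable_funPT.
Qed.

Let prob_atom J : P (atom J) = (weight J)%:E.
Proof.
rewrite /atom X_indep//.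
rewrite /weight -prodEFin; apply: eq_big => [j|j _]; first by rewrite inE.
by have [X1 X0] := X_bernoulli j; case: ifP => _.
Qed.

Let S_atom J w : atom J w -> S w = #|J|%:R.
Proof.
move=> h; rewrite /S -sum1_card natr_sum [RHS]big_mkcond; apply: eq_bigr => j _.
have /= -> : (X j @^-1` [set (j \in J)%:R]) w by apply: h; rewrite /= inE.
by case: ifP.
Qed.

Let sum_weight : \sum_J weight J = 1.
Proof.
rewrite /weight -bigA_distr big1// => j _.
by rewrite /= addrCA subrr addr0.
Qed.

Let measurable_S : measurable_fun setT S.
Proof. by apply: measurable_sum => j. Qed.

(** The atoms with [#|J|] in [B] are disjoint and contained in the event. They need not fill it, as
    the variables may take other values on a null set. *)
Let prob_ge (B : set R) : measurable B ->
  ((\sum_(J : {set 'I_n} | #|J|%:R \in B) weight J)%:E <= P (S @^-1` B))%E.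
Proof.
move=> mB; pose r := [seq J : {set 'I_n} <- index_enum _ | #|J|%:R \in B].
have mr : measurable (\bigcup_(J in [set` r]) atom J).
  by apply: fin_bigcup_measurable.
have -> : (\sum_(J : {set 'I_n} | #|J|%:R \in B) weight J)%:E =
  P (\bigcup_(J in [set` r]) atom J).
  rewrite content_fin_bigcup//.
    rewrite -fsbig_seq ?filter_uniq ?index_enum_uniq//= big_filter -sumEFin.
    by apply: eq_bigr => J _; rewrite prob_atom.
  apply/trivIsetP => J K _ _ JK; apply/seteqP; split => // w [hJ hK].
  case/eqP: JK; apply/setP => j.
  have /= eJ : (X j @^-1` [set (j \in J)%:R]) w by apply: hJ; rewrite /= inE.
  have /= eK : (X j @^-1` [set (j \in K)%:R]) w by apply: hK; rewrite /= inE.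
  have /eqP : (j \in J)%:R = (j \in K)%:R :> R by rewrite -eJ -eK.
  by rewrite eqr_nat; case: (j \in J); case: (j \in K).
apply: le_measure; rewrite ?inE//.
  by rewrite -[_ @^-1` _]setTI; exact: measurable_S.
move=> w [J /=]; rewrite mem_filter => /andP[JB _] /S_atom e.
by rewrite e; move: JB; rewrite inE.
Qed.

(** The opposite inequality is [prob_ge] for the complement of [B], because the weights sum to 1. *)
Lemma prob_bernoulli_sum (B : set R) : measurable B ->
  P (S @^-1` B) = (\sum_(J : {set 'I_n} | #|J|%:R \in B)
    \prod_j (if j \in J then p j else 1 - p j))%:E.
Proof.
move=> mB; apply/eqP; rewrite eq_le prob_ge// andbT.
have mSB : measurable (S @^-1` B).
  by rewrite -[_ @^-1` _]setTI; exact: measurable_S.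
have := prob_ge _ (measurableC mB); rewrite preimage_setC probability_setC//.
rewrite -[P (S @^-1` B)]fineK ?fin_num_measure// -EFinB !lee_fin.
have -> : \sum_(J : {set 'I_n} | #|J|%:R \in ~` B) weight J =
    1 - \sum_(J : {set 'I_n} | #|J|%:R \in B) weight J.
  rewrite -[X in X - _]sum_weight [X in X - _](bigID (fun J : {set 'I_n} =>
    #|J|%:R \in B)) /=.
  rewrite [RHS]addrC addKr; apply: eq_bigl => J.
  by apply/idP/negP; rewrite !inE.
by rewrite lerD2l lerN2.
Qed.

Let gf := poisson_binomial_gf [seq p j | j <- index_enum 'I_n].

Let gfE m : gf`_m = \sum_(J : {set 'I_n} | #|J| == m) weight J.
Proof. by rewrite /gf /poisson_binomial_gf big_map coef_prod_bernoulli_gf. Qed.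

Lemma prob_bernoulli_sum_eq m : fine (P [set w | S w = m%:R]) = gf`_m.
Proof.
rewrite gfE [[set w | _]](_ : _ = S @^-1` [set m%:R])//.
rewrite prob_bernoulli_sum//=; apply: eq_bigl => J.
apply/idP/eqP => [/set_mem /= h|->]; last exact/mem_set.
by apply/eqP; rewrite -(eqr_nat R); apply/eqP.
Qed.

Lemma prob_bernoulli_sum_le m :
  fine (P [set w | S w <= m%:R]) = \sum_(0 <= k < m.+1) gf`_k.
Proof.
rewrite [[set w | _]](_ : _ = S @^-1` `]-oo, m%:R]); last first.
  by apply/seteqP; split => w /=; rewrite in_itv.
rewrite prob_bernoulli_sum//= big_mkord.
under [RHS]eq_bigr do rewrite gfE.
rewrite (exchange_big_dep (fun J : {set 'I_n} => (#|J| < m.+1)%N)) /=;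
  last first.
  by move=> k J _ /eqP ->.
apply: eq_big => [J|J]; first by rewrite mem_setE in_itv /= ler_nat ltnS.
rewrite mem_setE in_itv /= ler_nat -ltnS => Jm.
rewrite [RHS](bigD1 (Ordinal Jm)) //= [X in _ + X]big1 ?addr0// =>
  k /andP[/eqP e].
by case/eqP; apply: val_inj.
Qed.

End bernoulli_sum.

(** * Reduction of tail masses and infinite series to finite sums *)

Lemma poisson_tail_minE {R : realType} (lambda : R) m : 0 < lambda ->
  poisson_tail_min lambda m =
  Num.min (\sum_(0 <= k < m.+1) poisson_weight lambda k)
          (1 - \sum_(0 <= k < m.+1) poisson_weight lambda k).
Proof.
move=> l0; have hd : poisson_prob lambda 0%N [set k | (k <= m)%N] =
    (\sum_(0 <= k < m.+1) poisson_weight lambda k)%:E.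
  rewrite /poisson_prob l0 esum_fset; last first.
  - by move=> k _; rewrite lee_fin poisson_pmf_ge0.
  - by rewrite [X in finite_set X](_ : _ = `I_m.+1)//; exact: finite_II.
  rewrite [X in \sum_(_ \in X) _](_ : _ =
    `I_m.+1)// -fsbig_ord big_mkord sumEFin.
  congr EFin; apply: eq_bigr => k _.
  by rewrite /poisson_pmf l0 /poisson_weight mulrC.
rewrite /poisson_tail_min hd /=; congr Num.min.
rewrite [[set k | _]](_ : _ = ~` [set k | (k <= m)%N]); last first.
  by apply/seteqP; split => k /=; rewrite ltnNge => /negP.
by rewrite probability_setC//= hd.
Qed.

Lemma nneseries_fin_le {R : realType} (u : nat -> R) (b : R) :
  (forall m, 0 <= u m) -> (forall M, \sum_(0 <= m < M) u m <= b) ->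
  (\sum_(0 <= m <oo) (u m)%:E <= b%:E)%E.
Proof.
move=> u0 ub; apply: lime_le.
  by apply: is_cvg_nneseries => m _ _; rewrite lee_fin.
by apply: nearW => M; rewrite sumEFin lee_fin.
Qed.

(** Cauchy-Schwarz against the Poisson weights, whose partial sums are at most 1. It derives the
    total variation and Wasserstein bounds from the chi-square ones. *)
Lemma sqr_sum_norm_le {R : realType} (lambda : R) (h : nat -> R) M :
  0 < lambda ->
  (\sum_(0 <= m < M) `|h m|) ^+ 2 <=
  \sum_(0 <= m < M) h m ^+ 2 / poisson_weight lambda m.
Proof.
move=> l0; have po0 := poisson_weight_gt0 _ l0.
set po := poisson_weight lambda in po0 *.
have -> : \sum_(0 <= m < M) `|h m| = \sum_(0 <= m < M) po m * (`|h m| / po m).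
  by apply: eq_bigr => m _; rewrite mulrC divfK// gt_eqF.
apply: (le_trans (sqr_weighted_sum_le _ _ _ po0)).
have -> : \sum_(0 <= m < M) po m * (`|h m| / po m) ^+ 2 =
    \sum_(0 <= m < M) h m ^+ 2 / po m.
  apply: eq_bigr => m _; rewrite expr_div_n real_normK ?num_real//.
  by field; rewrite gt_eqF.
rewrite ler_piMl ?poisson_weight_sum_le1//.
by apply: sumr_ge0 => m _; rewrite divr_ge0 ?sqr_ge0// ltW.
Qed.

Lemma norm_le_sqr {R : realDomainType} (x y : R) :
  0 <= y -> x ^+ 2 <= y ^+ 2 -> `|x| <= y.
Proof.
by move=> y0 xy; rewrite -(@ler_pXn2r _ 2) ?nnegrE// real_normK ?num_real.
Qed.

Theorem theorem3p4 (R : realType) (d : measure_display) (T : measurableType d)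
  (P : probability T R) (n : nat) (X : 'I_n -> {RV P >-> R}) (p : 'I_n -> R)
  (X_indep : mutually_independent X)
  (X_bernoulli : forall j, is_bernoulli (X j) (p j))
  (S : T -> R) (S_def : forall w, S w = \sum_(j < n) X j w)
  (lambda lambda2 theta c1 : R)
  (lambda_def : lambda = \sum_(j < n) p j)
  (lambda_gt0 : 0 < lambda)
  (lambda2_def : lambda2 = \sum_(j < n) p j ^+ 2)
  (theta_def : theta = lambda2 / lambda)
  (theta_lt1 : theta < 1)
  (c1_def : c1 = Num.sqrt (expR 1) - 1) :
  let prS_eq (m : nat) : R := fine (P [set w | S w = m%:R]) in
  let prS_le (m : nat) : R := fine (P [set w | S w <= m%:R]) in
  let po (m : nat) : R := expR (- lambda) * (lambda ^+ m / (m`!)%:R) in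
  let Z (m : nat) : R := poisson_tail_min lambda m in
  [/\ (\sum_(0 <= m <oo) (`|prS_eq m / po m - 1| ^+ 2 * po m)%:E
         <= (2 * c1 ^+ 2 * theta ^+ 2 / (1 - theta) ^+ 3)%:E)%E,
      ((2^-1)%:E * \sum_(0 <= m <oo) (`|prS_eq m - po m|)%:E
         <= (c1 * theta / (Num.sqrt 2 * (1 - theta) `^ (3 / 2)))%:E)%E,
      (\sum_(0 <= m <oo) (`|prS_le m - \sum_(0 <= j < m.+1) po j|)%:E
         <= (c1 * lambda2 / (Num.sqrt lambda * (1 - theta)))%:E)%E,
      (forall m : nat, `|prS_le m - \sum_(0 <= j < m.+1) po j|
         <= Num.sqrt 2 * c1 * theta / (1 - theta) `^ (3 / 2)
            * Num.sqrt (Z m)) &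
      (forall m : nat, `|prS_eq m - po m|
         <= Num.sqrt 6 * c1 * theta / ((1 - theta) ^+ 2 * Num.sqrt lambda)
            * Num.sqrt (Z m))].
Proof.
move=> prS_eq prS_le po Z.
have c0 : 0 <= c1 by rewrite c1_def; apply: le_trans (sqrt_expR1_sub1_ge); lra.
pose ps := [seq p j | j <- index_enum 'I_n].
have lE : \sum_(x <- ps) x = lambda by rewrite big_map lambda_def.
have tE : (\sum_(x <- ps) x ^+ 2) / \sum_(x <- ps) x = theta.
  by rewrite lE big_map theta_def lambda2_def.
have t0 : 0 <= theta.
  rewrite -tE lE divr_ge0 ?(ltW lambda_gt0)//.
  by apply: sumr_ge0 => x _; rewrite sqr_ge0.
have {}S_def : S = (fun w => \sum_(j < n) X j w) by apply/funext.
pose L := poisson_binomial_gf ps.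
have eqE m : prS_eq m = L`_m.
  by rewrite /prS_eq S_def; exact: prob_bernoulli_sum_eq.
have leE m : prS_le m - \sum_(0 <= k < m.+1) po k =
  \sum_(0 <= k < m.+1) (L`_k - po k).
  by rewrite sumrB /prS_le S_def; congr (_ - _); exact: prob_bernoulli_sum_le.
have ZE m : Z m = Num.min (\sum_(0 <= k < m.+1) po k)
  (1 - \sum_(0 <= k < m.+1) po k).
  exact: poisson_tail_minE.
have Z0 m : 0 <= Z m by rewrite le_min !fine_ge0.
have po0 m : 0 < po m by exact: poisson_weight_gt0.
have lps : 0 < \sum_(x <- ps) x by rewrite lE.
have tps : (\sum_(x <- ps) x ^+ 2) / (\sum_(x <- ps) x) < 1 by rewrite tE.
have := poisson_binomial_chi2 _ lps tps;
  have := poisson_binomial_cdf_chi2 _ lps tps.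
have := poisson_binomial_cdf_sqr_le _ lps tps;
  have := poisson_binomial_pmf_sqr_le _ lps tps.
rewrite -/L tE lE -c1_def -/po => pmf_le cdf_le cdf_chi2 chi2.
have u0 : 0 < 1 - theta by rewrite subr_gt0.
have v2 : ((1 - theta) `^ (3 / 2)) ^+ 2 = (1 - theta) ^+ 3.
  by rewrite -powR_mulrn ?powR_ge0// -powRrM divfK ?pnatr_eq0// powR_mulrn//
    ltW.
have v0 : 0 < (1 - theta) `^ (3 / 2) by rewrite powR_gt0.
have l2E : lambda2 = theta * lambda by rewrite theta_def divfK// gt_eqF.
split.
- apply: nneseries_fin_le => [m|M]; first by rewrite mulr_ge0 ?sqr_ge0// ltW.
  have -> : \sum_(0 <= m < M) `|prS_eq m / po m - 1| ^+ 2 * po m =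
      \sum_(0 <= m < M) (L`_m - po m) ^+ 2 / po m.
    apply: eq_bigr => m _; rewrite eqE real_normK ?num_real//.
    by field; rewrite gt_eqF.
  apply: (le_trans (chi2 M)); rewrite le_eqVlt /charlier_norm2_bound;
    apply/orP; left; apply/eqP.
  by rewrite -[2`!]/2%N; field; rewrite !gt_eqF.
(* The sum without the factor one half is at most the square root of the chi-square bound, which is
   [2 * y]. *)
- set y := c1 * theta / _.
  have y0 : 0 <= y by rewrite /y divr_ge0 ?mulr_ge0 ?sqrtr_ge0 ?(ltW v0).
  have y2 : (2 * y) ^+ 2 = charlier_norm2_bound lambda (c1 ^+ 2) theta 1.
    rewrite exprMn /y expr_div_n.
    rewrite [(Num.sqrt 2 * _) ^+ 2]exprMn v2 sqr_sqrtr// /charlier_norm2_bound.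
    by rewrite -[2`!]/2%N; field; rewrite !gt_eqF.
  have h : (\sum_(0 <= m <oo) (`|prS_eq m - po m|)%:E <= (2 * y)%:E)%E.
    apply: nneseries_fin_le => // M; rewrite -[leLHS]ger0_norm;
      last exact: sumr_ge0.
    apply: norm_le_sqr; first by rewrite mulr_ge0.
    rewrite y2; apply: le_trans (chi2 M); under eq_bigr do rewrite eqE.
    exact: sqr_sum_norm_le.
  apply: (le_trans (lee_wpmul2l _ h)); first by rewrite lee_fin invr_ge0.
  by rewrite -EFinM mulrA mulVf ?mul1r// pnatr_eq0.
- set y := c1 * lambda2 / _.
  have l20 : 0 <= lambda2 by rewrite l2E mulr_ge0// ltW.
  have y0 : 0 <= y by rewrite /y divr_ge0 ?mulr_ge0 ?sqrtr_ge0 ?(ltW u0).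
  have y2 : y ^+ 2 = charlier_norm2_bound lambda (c1 ^+ 2) theta 0.
    rewrite /y expr_div_n [(Num.sqrt lambda * _) ^+ 2]exprMn sqr_sqrtr ?(ltW
      lambda_gt0)//.
    rewrite l2E /charlier_norm2_bound -[1`!]/1%N; field.
    by rewrite !gt_eqF.
  apply: nneseries_fin_le => // M; rewrite -[leLHS]ger0_norm;
    last exact: sumr_ge0.
  apply: norm_le_sqr => //; rewrite y2; apply: le_trans (cdf_chi2 M).
  under eq_bigr do rewrite leE.
  exact: sqr_sum_norm_le.
(* The factor [Num.sqrt 2] is the root of the [2!] in the bound with [r = 1]; in the last case
   [Num.sqrt 6] comes from [3!] with [r = 2]. *)
- move=> m; apply: norm_le_sqr.
    rewrite mulr_ge0 ?sqrtr_ge0// divr_ge0 ?(ltW v0)//.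
    by rewrite !mulr_ge0 ?sqrtr_ge0.
  rewrite leE; apply: (le_trans (cdf_le m)); rewrite -ZE.
  rewrite [leRHS]exprMn expr_div_n v2 sqr_sqrtr// !exprMn sqr_sqrtr//.
  rewrite le_eqVlt /charlier_norm2_bound -[2`!]/2%N; apply/orP; left; apply/eqP.
  by field; rewrite !gt_eqF.
- move=> m; apply: norm_le_sqr.
    rewrite mulr_ge0 ?sqrtr_ge0// divr_ge0 ?mulr_ge0 ?sqrtr_ge0 ?(ltW u0)//.
  rewrite eqE; apply: (le_trans (pmf_le m)); rewrite -ZE.
  rewrite [leRHS]exprMn expr_div_n sqr_sqrtr// !exprMn !sqr_sqrtr ?(ltW
    lambda_gt0)//.
  rewrite le_eqVlt /charlier_norm2_bound -[3`!]/6%N; apply/orP; left; apply/eqP.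
  by field; rewrite !gt_eqF.
Qed.
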